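(* There exist an integer $\Delta_0$ and a constant $c>0$ such that the following holds. For every integer $\Delta\ge\Delta_0$ there is $N_0=N_0(\Delta)\ge 5\Delta\log\Delta$ such that for every integer $n>N_0$, \[ f(n,\Delta)\ge \frac12\cdot\frac{\log\Delta}{\Delta}\,n. \] In addition, $f^*(n,\Delta)\ge c\,\frac{\log\Delta}{\Delta}\,n$.
   Context: An $n\times n$ bipartite graph is a bipartite graph $G=(A\cup B,E)$ with a fixed bipartition into parts $A,B$ with $|A|=|B|=n$. A bi-hole of size $k$ in such a graph is a pair $(X,Y)$ with $X\subseteq A$, $Y\subseteq B$, $|X|=|Y|=k$, such that no edge of $G$ joins a vertex of $X$ to a vertex of $Y$. $f(n,\Delta)$ is the largest integer $k$ such that every $n\times n$ bipartite graph $G=(A\cup B,E)$ with $\deg(a)\le\Delta$ for all $a\in A$ contains a bi-hole of size $k$. $f^*(n,\Delta)$ is the largest integer $k$ such that every $n\times n$ bipartite graph with maximum degree at most $\Delta$ contains a bi-hole of size $k$. $\log$ denotes the natural logarithm. *)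

(* Defs.v *)
From mathcomp Require Import all_boot all_order all_algebra.
From mathcomp Require Import all_reals exp.

Set Implicit Arguments.
Unset Strict Implicit.
Unset Printing Implicit Defensive.

(* An n x n bipartite graph is given by its edge set: both parts A and B are
   (disjoint) copies of 'I_n, and (a, b) \in G means that a in A is adjacent to
   b in B. *)
Notation bigraph n := {set 'I_n * 'I_n}.

Section Biholes.
Variable n : nat.
Implicit Types (G : bigraph n) (X Y : {set 'I_n}) (k D : nat).

Definition degA G (a : 'I_n) : nat := #|[set b | (a, b) \in G]|.
Definition degB G (b : 'I_n) : nat := #|[set a | (a, b) \in G]|.

Definition degA_le G D : bool := [forall a, degA G a <= D].
Definition max_deg_le G D : bool :=
  degA_le G D && [forall b, degB G b <= D].

Definition bihole G k X Y : bool :=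
  [&& #|X| == k, #|Y| == k
    & [forall x in X, forall y in Y, (x, y) \notin G]].

Definition has_bihole G k : bool := [exists X, exists Y, bihole G k X Y].

End Biholes.

(* The maxima range over k <= n, which is no restriction, since a bi-hole has
   size at most n; k = 0 always qualifies, so they are attained (see fP, fstarP
   below). *)
Definition f (n D : nat) : nat :=
  \max_(k < n.+1 |
     [forall G : bigraph n, degA_le G D ==> has_bihole G k]) k.

Definition fstar (n D : nat) : nat :=
  \max_(k < n.+1 |
     [forall G : bigraph n, max_deg_le G D ==> has_bihole G k]) k.

Lemma has_bihole0 n (G : bigraph n) : has_bihole G 0.
Proof.
apply/existsP; exists set0; apply/existsP; exists set0.
rewrite /bihole cards0 eqxx /=.
by apply/forall_inP => x; rewrite inE.
Qed.

Lemma has_bihole_le n (G : bigraph n) k : has_bihole G k -> k <= n.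
Proof.
case/existsP=> X /existsP[Y /and3P[/eqP <- _ _]].
by rewrite -[leqRHS]card_ord max_card.
Qed.

Lemma max_bihole_spec n (P : pred (bigraph n)) (G0 : bigraph n) k :
  P G0 ->
  (forall G, P G -> has_bihole G k) <->
  k <= n /\ [forall G, P G ==> has_bihole G k].
Proof.
move=> PG0; split=> [H|[_ /forallP H] G PG]; last exact: (implyP (H G)).
split; first exact: has_bihole_le (H _ PG0).
by apply/forallP => G; apply/implyP/H.
Qed.

Lemma max_biholeP n (P : pred (bigraph n)) (G0 : bigraph n) :
  P G0 ->
  let m := \max_(k < n.+1 | [forall G, P G ==> has_bihole G k]) k in
  (forall G, P G -> has_bihole G m) /\
  (forall k, (forall G, P G -> has_bihole G k) -> k <= m).
Proof.
move=> PG0 /=; split=> [|k /(max_bihole_spec _ PG0)[kn Hk]].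
  have H0 : [forall G, P G ==> has_bihole G (ord0 : 'I_n.+1)].
    by apply/forallP => G; rewrite has_bihole0 implybT.
  by rewrite (bigmax_eq_arg ord0) //; case: arg_maxnP => // i /forallP H _ G;
    apply/implyP.
rewrite -ltnS in kn.
exact: (@leq_bigmax_cond _ _ (fun i : 'I_n.+1 => i : nat) (Ordinal kn)).
Qed.

Lemma degA_le_set0 n D : degA_le (set0 : bigraph n) D.
Proof.
by apply/forallP => a; rewrite /degA eq_card0 // => b; rewrite !inE.
Qed.

Lemma max_deg_le_set0 n D : max_deg_le (set0 : bigraph n) D.
Proof.
rewrite /max_deg_le degA_le_set0 /=.
by apply/forallP => b; rewrite /degB eq_card0 // => a; rewrite !inE.
Qed.

Lemma fP n D :
  (forall G : bigraph n, degA_le G D -> has_bihole G (f n D)) /\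
  (forall k, (forall G : bigraph n, degA_le G D -> has_bihole G k) ->
     k <= f n D).
Proof. exact: max_biholeP (degA_le_set0 n D). Qed.

Lemma fstarP n D :
  (forall G : bigraph n, max_deg_le G D -> has_bihole G (fstar n D)) /\
  (forall k, (forall G : bigraph n, max_deg_le G D -> has_bihole G k) ->
     k <= fstar n D).
Proof. exact: max_biholeP (max_deg_le_set0 n D). Qed.

(* Main.v *)
Require Import Defs.
From mathcomp Require Import all_boot all_order all_algebra.
From mathcomp Require Import all_reals sequences exp.
From mathcomp Require Import ring lra.
Import Order.TTheory GRing.Theory Num.Theory.
Local Open Scope ring_scope.

(** Build Y greedily: always add the vertex of B with the fewest neighbours
    among the vertices of A that still have no neighbour in Y.  By averaging,
    each of the k steps loses at most a fraction D / (n - k) of those vertices,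
    so about n exp(- k D / n) of them survive.  For k ~ n ln D / (2 D) this is
    about n / sqrt D, far more than k. *)

Definition nonadj n (G : bigraph n) (Y : {set 'I_n}) : {set 'I_n} :=
  [set a | [forall b in Y, (a, b) \notin G]].

Lemma nonadjU1 n (G : bigraph n) (Y : {set 'I_n}) b :
  nonadj n G (b |: Y) = nonadj n G Y :\: [set a | (a, b) \in G].
Proof.
apply/setP => a; rewrite !inE; apply/forall_inP/andP => [H|[nab /forall_inP H]].
  split; first by apply: H; rewrite setU11.
  by apply/forall_inP => y yY; apply: H; rewrite setU1r.
by move=> y /setU1P[-> //|/H].
Qed.

(** Averaging: at most [D * #|U|] edges leave [U], so the vertex outside [Y] with the fewest
    neighbours in [U] has at most the mean over the [n - #|Y|] candidates. *)
Lemma exists_low_degree n (G : bigraph n) D (U Y : {set 'I_n}) :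
  degA_le G D -> (#|Y| < n)%N ->
  exists2 b, b \notin Y &
    ((n - #|Y|) * #|U :&: [set a | (a, b) \in G]| <= D * #|U|)%N.
Proof.
move=> /forallP degG ltYn.
have [b0 b0Y] : exists b, b \in ~: Y.
  by apply/card_gt0P; rewrite cardsCs setCK card_ord subn_gt0.
pose d b := #|U :&: [set a | (a, b) \in G]|.
case: (arg_minnP d b0Y) => b bY minb.
exists b; first by rewrite -in_setC.
have -> : (n - #|Y|)%N = #|~: Y| by rewrite [in RHS]cardsCs setCK card_ord.
apply: (@leq_trans (\sum_(y in ~: Y) d y)); first by rewrite -sum_nat_const leq_sum.
apply: (@leq_trans (\sum_y d y)).
  by rewrite [leqRHS](bigID (mem (~: Y))) /= leq_addr.
have dE y : d y = (\sum_(a in U) ((a, y) \in G : nat))%N.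
  rewrite -big_mkcondr sum1_card; apply: eq_card => a.
  by rewrite !inE.
under eq_bigr do rewrite dE.
rewrite exchange_big mulnC -sum_nat_const /= leq_sum // => a _.
by apply: leq_trans (degG a); rewrite -big_mkcond sum1_card /degA cardsE.
Qed.

(** Induction on the number [j] of greedy steps, with the final size [k] held fixed so that every
    step has the same loss factor. *)
Lemma exists_large_nonadj (R : realFieldType) n (G : bigraph n) D k j :
  degA_le G D -> (j <= k)%N -> (k + D < n)%N ->
  exists2 Y : {set 'I_n}, #|Y| = j &
    n%:R * (1 - D%:R / (n - k)%:R) ^+ j <= #|nonadj n G Y|%:R :> R.
Proof.
move=> degG + kDn; have ltkn : (k < n)%N by apply: leq_ltn_trans kDn; apply: leq_addr.
have nk0 : 0 < (n - k)%:R :> R by rewrite ltr0n subn_gt0.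
have q0 : 0 <= 1 - D%:R / (n - k)%:R :> R.
  by rewrite subr_ge0 ler_pdivrMr // mul1r ler_nat leq_subRL ltnW.
elim: j => [_|j IHj ltjk].
  exists set0; first by rewrite cards0.
  rewrite expr0 mulr1 ler_nat -[leqLHS]card_ord -cardsT subset_leq_card //.
  by apply/subsetP => a _; rewrite inE; apply/forall_inP => b; rewrite inE.
have [Y cY leU] := IHj (ltnW ltjk).
set U := nonadj n G Y in leU.
have [|b bY degb] := @exists_low_degree n G D U Y degG.
  by rewrite cY (ltn_trans ltjk).
exists (b |: Y); first by rewrite cardsU1 bY cY.
(* The loss is at most [D * #|U| / (n - j)], which [j <= k] weakens to the uniform
   [D * #|U| / (n - k)]. *)
rewrite nonadjU1 -/U exprSr mulrA; apply: le_trans (ler_wpM2r q0 leU) _.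
rewrite cardsD [in leRHS]natrB ?subset_leq_card ?subsetIl //.
rewrite mulrBr mulr1 lerD2l lerN2 mulrA ler_pdivlMr // -!natrM ler_nat.
rewrite mulnC [leqRHS]mulnC; apply: leq_trans degb; rewrite leq_mul2r cY.
by rewrite leq_sub2l ?orbT // ltnW.
Qed.

Lemma has_bihole_pow (R : realFieldType) n (G : bigraph n) D k :
  degA_le G D -> (k + D < n)%N ->
  k%:R <= n%:R * (1 - D%:R / (n - k)%:R) ^+ k :> R -> has_bihole G k.
Proof.
move=> degG kDn le_k.
have [Y cY leU] := @exists_large_nonadj R n G D k k degG (leqnn k) kDn.
have /card_geqP[s [us ss sU]] : (k <= #|nonadj n G Y|)%N.
  by rewrite -(ler_nat R) (le_trans le_k).
apply/existsP; exists [set a in s]; apply/existsP; exists Y.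
rewrite /bihole cY cardsE (card_uniqP us) ss !eqxx /=.
apply/forall_inP => a; rewrite inE => /sU.
by rewrite inE.
Qed.

(** Take inverses in [1 + y <= expR y] at [y = x / (1 - x)], where [1 + y] is the inverse of
    [1 - x]. *)
Lemma expRN_le_1B (R : realType) (x : R) : x < 1 -> expR (- (x / (1 - x))) <= 1 - x.
Proof.
move=> x1; have x1' : 0 < 1 - x by lra.
rewrite expRN invf_ple ?posrE ?expR_gt0 //.
apply: le_trans (expR_ge1Dx _).
by rewrite le_eqVlt; apply/orP; left; apply/eqP; field; lra.
Qed.

Lemma expRN_le_pow (R : realType) n k D :
  (k + D < n)%N ->
  expR (- (k%:R * D%:R / (n%:R - k%:R - D%:R))) <=
    (1 - D%:R / (n - k)%:R) ^+ k :> R.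
Proof.
move=> kDn; have kDn' : k%:R + D%:R < n%:R :> R by rewrite -natrD ltr_nat.
have D0 : 0 <= D%:R :> R by [].
rewrite natrB; last by rewrite ltnW // (leq_ltn_trans _ kDn) ?leq_addr.
have x1 : D%:R / (n%:R - k%:R) < 1 :> R by rewrite ltr_pdivrMr; lra.
have q0 : 0 <= 1 - D%:R / (n%:R - k%:R) :> R by lra.
have := @lerXn2r _ k _ _ (expR_ge0 _) q0 (expRN_le_1B R _ x1).
apply: le_trans.
rewrite -expRM_natl ler_expR le_eqVlt; apply/orP; left; apply/eqP.
by field; lra.
Qed.

Lemma sqr_le_expR (R : realType) (x : R) : 0 <= x -> (1 + x / 2) ^+ 2 <= expR x.
Proof.
move=> x0; have -> : expR x = expR (x / 2) ^+ 2 by rewrite -expRM_natl; congr expR; field.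
by rewrite lerXn2r ?nnegrE ?expR_ge0 ?expR_ge1Dx //; lra.
Qed.

Lemma bihole_size_le (R : realType) n k D :
  24 <= ln D%:R :> R -> (24 * D * D < n)%N ->
  k%:R <= 1 / 2 * (ln D%:R / D%:R) * n%:R + 1 :> R ->
  (k + D < n)%N /\ k%:R <= n%:R * (1 - D%:R / (n - k)%:R) ^+ k :> R.
Proof.
set L : R := ln D%:R => L24 Dn kle.
(* [ln] is 0 at nonpositive arguments, so a large logarithm forces [D] to be positive. *)
have D0 : 0 < D%:R :> R.
  by rewrite ltNge; apply/negP => /ln0 L0; rewrite /L L0 in L24; lra.
have DE : D%:R = expR L by rewrite lnK.
(* The square contributes [L ^+ 2 / 4], which reaches [6 * L] exactly from [L = 24] on. *)
have DL : 6 * L <= D%:R.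
  have := @sqr_le_expR R L; rewrite -DE; nra.
have nD : 24 * D%:R * D%:R < n%:R :> R by rewrite -!natrM ltr_nat.
have n0 : 0 < n%:R :> R by nra.
pose u : R := L / D%:R.
have uD : u * D%:R = L by rewrite /u; field; lra.
have u0 : 0 < u by rewrite divr_gt0 //; lra.
have u6 : u <= 1 / 6 by rewrite ler_pdivrMr; lra.
rewrite -/u in kle.
have D1 : 144 <= D%:R :> R by lra.
have k0 : 0 <= k%:R :> R by [].
have kDn : k%:R + D%:R < n%:R / 6 :> R by nra.
have kDnN : (k + D < n)%N by rewrite -(ltr_nat R) natrD; lra.
split => //; apply: le_trans (ler_wpM2l (ltW n0) (@expRN_le_pow R n k D kDnN)).
(* The numerator is at most [L * n / 2 + D] and the denominator exceeds [5 * n / 6]; the ratio is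
   about [3 / 5 * L], and [3 / 4] leaves room for the term [D]. *)
have le_exp : k%:R * D%:R / (n%:R - k%:R - D%:R) <= 3 / 4 * L :> R.
  rewrite ler_pdivrMr; last lra.
  apply: (@le_trans _ _ (1 / 2 * L * n%:R + D%:R)); first by rewrite -uD; nra.
  nra.
apply: (@le_trans _ _ (n%:R * expR (- (3 / 4 * L)))); last first.
  by rewrite ler_pM2l // ler_expR lerN2.
have -> : expR (- (3 / 4 * L)) = expR (L / 4) / D%:R.
  by rewrite DE -expRN -expRD; congr expR; field.
rewrite mulrA ler_pdivlMr //.
(* After multiplication by [D], with [D <= n], it remains to see that
   [1 + L / 2 <= expR (L / 4)]. *)
apply: (@le_trans _ _ (1 / 2 * L * n%:R + D%:R)); first by rewrite -uD; nra.
have t6 : 1 + L / 2 <= expR (L / 4).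
  by apply: le_trans (sqr_le_expR _ _ _); nra.
nra.
Qed.

Lemma f_ge (R : realType) n D :
  24 <= ln D%:R :> R -> (24 * D * D < n)%N ->
  1 / 2 * (ln D%:R / D%:R) * n%:R <= (f n D)%:R :> R.
Proof.
move=> L24 Dn; set x := (X in X <= _).
have x0 : 0 <= x by rewrite !mulr_ge0 ?invr_ge0 //; lra.
have /andP[xk kx] := truncn_itv x0.
(* Rounding [x] up to an integer above it costs at most 1, the slack allowed in [bihole_size_le]. *)
have [|kDn le_k] := @bihole_size_le R n (Num.truncn x).+1 D L24 Dn.
  by rewrite -natr1 lerD2r.
apply: le_trans (ltW kx) _; rewrite ler_nat; apply: (fP n D).2 => G degG.
exact: has_bihole_pow degG kDn le_k.
Qed.

Lemma f_le_fstar n D : (f n D <= fstar n D)%N.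
Proof.
by apply: (fstarP n D).2 => G /andP[degG _]; apply: (fP n D).1.
Qed.

Theorem theorem1p1 (R : realType) :
  exists (Delta0 : nat) (c : R), 0 < c /\
    forall Delta : nat, (Delta0 <= Delta)%N ->
      exists N0 : nat,
        5 * Delta%:R * ln (Delta%:R : R) <= N0%:R /\
        forall n : nat, (N0 < n)%N ->
          1 / 2 * (ln (Delta%:R : R) / Delta%:R) * n%:R <= (f n Delta)%:R /\
          c * (ln (Delta%:R : R) / Delta%:R) * n%:R <= (fstar n Delta)%:R.
Proof.
(* This threshold makes [ln D >= 24]; [c = 1 / 2] works because [fstar] is at least [f]. *)
exists (Num.truncn (expR 24 : R)).+1, (1 / 2); split; first lra.
move=> D leD; have eD : expR 24 < D%:R :> R.
  by apply: lt_le_trans (truncnS_gt _) _; rewrite ler_nat.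
have D0 : 0 < D%:R :> R by apply: lt_trans eD; apply: expR_gt0.
have L24 : 24 <= ln D%:R :> R by rewrite -ler_expR lnK ?posrE // ltW.
(* [ln D < D] puts this above [5 * D * ln D]. *)
exists (24 * D * D)%N; split.
  by have := ln_sublinear D0; rewrite !natrM; nra.
move=> n Dn; have le_f := @f_ge R n D L24 Dn.
by split=> //; apply: le_trans le_f _; rewrite ler_nat f_le_fstar.
Qed.
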